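(* Let target rates $\mathcal I^0_l>0$, $l=1,\dots,L$, and a sum power $P_T>0$ be given. The optimal value of $$\textbf{FOP}:\ \max_{\Sigma_{1:L}}\ \min_{1\le l\le L}\frac{\mathcal I_l(\Sigma_{1:L},\Phi)}{\mathcal I^0_l}\quad\text{s.t. }\Sigma_l\succeq0,\ \sum_{l=1}^L\mathrm{Tr}(\Sigma_l)\le P_T$$ is at least $1$ if and only if the optimal value of $$\textbf{EFOP}:\ \max_{\{T,R,p\}}\ \min_{1\le m\le M_l,\ 1\le l\le L}\frac{\gamma_{l,m}}{\gamma^0_l}\quad\text{s.t. }\|p\|_1\le P_T$$ is at least $1$, where $M_l=\mathrm{Rank}(H_{l,l})$ and $\gamma^0_l=e^{\mathcal I^0_l/M_l}-1$.
   Context: A MIMO B-MAC network has $L$ data links. Link $l$ has transmitter $T_l$ with $L_{T_l}$ antennas and receiver $R_l$ with $L_{R_l}$ antennas; $H_{l,k}\in\mathbb C^{L_{R_l}\times L_{T_k}}$ is the channel matrix from $T_k$ to $R_l$. The input of link $k$ is circularly symmetric complex Gaussian with covariance $\Sigma_k\succeq0$, and the noise at each receiver is circularly symmetric complex Gaussian with identity covariance. A coupling matrix $\Phi\in\{0,1\}^{L\times L}$ with $\Phi_{l,l}=0$ specifies whether the signal of link $k$ still interferes with link $l$ after interference cancellation ($\Phi_{l,k}=1$) or is completely cancelled ($\Phi_{l,k}=0$); $\Phi$ is assumed valid, i.e. realizable by a scheme in which each signal is decoded by at most one receiver. For $\Sigma_{1:L}$ let $\Omega_l=I+\sum_{k=1}^L\Phi_{l,k}H_{l,k}\Sigma_kH_{l,k}^\dagger$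 and $\mathcal I_l(\Sigma_{1:L},\Phi)=\log\left|I+H_{l,l}\Sigma_lH_{l,l}^\dagger\Omega_l^{-1}\right|$. Streams: with $M_l$ streams for link $l$, a strategy $\{T,R,p\}$ consists of unit-norm transmit vectors $t_{l,m}\in\mathbb C^{L_{T_l}}$ (collected in $T$), powers $p_{l,m}\ge0$ (collected in $p$), and unit-norm receive vectors $r_{l,m}$ (collected in $R$); it corresponds to input covariances $\Sigma_l=\sum_m p_{l,m}t_{l,m}t_{l,m}^\dagger$. Streams of link $l$ are decoded in order $m=1,\dots,M_l$ with cancellation. Cross-talk coefficients: $\Psi^{k,n}_{l,m}=0$ if $k=l,m\ge n$; $=|r_{l,m}^\dagger H_{l,l}t_{l,n}|^2$ if $k=l,m<n$; $=\Phi_{l,k}|r_{l,m}^\dagger H_{l,k}t_{k,n}|^2$ otherwise. SINR: $\gamma_{l,m}=\dfrac{p_{l,m}|r_{l,m}^\dagger H_{l,l}t_{l,m}|^2}{1+\sum_{k}\sum_{n=1}^{M_k}p_{k,n}\Psi^{k,n}_{l,m}}$. *)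

(* Defs.v *)
From Stdlib Require Import Reals Lra ClassicalEpsilon FunctionalExtensionality
  PropExtensionality.
From HB Require Import structures.
From mathcomp Require Import all_boot all_order all_algebra.

Set Implicit Arguments. Unset Strict Implicit. Unset Printing Implicit Defensive.

Definition Req_bool (x y : R) : bool := if Req_EM_T x y then true else false.

Lemma Req_boolP : Equality.axiom Req_bool.
Proof. by move=> x y; rewrite /Req_bool; case: Req_EM_T => h; constructor. Qed.

HB.instance Definition _ := hasDecEq.Build R Req_boolP.

Definition R_find (P : pred R) (n : nat) : option R :=
  match excluded_middle_informative (exists x, P x) with
  | left h => Some (proj1_sig (constructive_indefinite_description _ h))
  | right _ => None
  end.

Lemma R_find_correct (P : pred R) n x : R_find P n = Some x -> P x.
Proof.
rewrite /R_find; case: excluded_middle_informative => // h [<-].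
exact: proj2_sig (constructive_indefinite_description _ h).
Qed.

Lemma R_find_complete (P : pred R) : (exists x, P x) -> exists n, R_find P n.
Proof.
move=> h; exists 0%N; rewrite /R_find; case: excluded_middle_informative => //.
Qed.

Lemma R_find_ext (P Q : pred R) : P =1 Q -> R_find P =1 R_find Q.
Proof. by move=> /functional_extensionality ->. Qed.

HB.instance Definition _ :=
  hasChoice.Build R R_find_correct R_find_complete R_find_ext.

Record Cplx := mkC { cre : R; cim : R }.

Definition C_to (z : Cplx) : R * R := (cre z, cim z).
Definition C_of (p : R * R) : Cplx := mkC p.1 p.2.
Lemma C_toK : cancel C_to C_of. Proof. by case. Qed.

HB.instance Definition _ := Choice.copy Cplx (can_type C_toK).

Lemma C_ext (x y : Cplx) : cre x = cre y -> cim x = cim y -> x = y.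
Proof. by case: x; case: y => /= ? ? ? ? -> ->. Qed.

Local Open Scope R_scope.
Definition Czero : Cplx := mkC 0 0.
Definition Cone : Cplx := mkC 1 0.
Definition Copp (x : Cplx) : Cplx := mkC (- cre x) (- cim x).
Definition Cadd (x y : Cplx) : Cplx := mkC (cre x + cre y) (cim x + cim y).
Definition Cmul (x y : Cplx) : Cplx :=
  mkC (cre x * cre y - cim x * cim y) (cre x * cim y + cim x * cre y).
Definition Cinv (x : Cplx) : Cplx :=
  mkC (cre x / (cre x ^ 2 + cim x ^ 2)) (- cim x / (cre x ^ 2 + cim x ^ 2)).
Definition Cconj (x : Cplx) : Cplx := mkC (cre x) (- cim x).
Definition Cabs2 (x : Cplx) : R := cre x ^ 2 + cim x ^ 2.
Definition Cmod (x : Cplx) : R := sqrt (Cabs2 x).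
Definition RtoC (a : R) : Cplx := mkC a 0.

Lemma CaddA : associative Cadd.
Proof. by move=> x y z; apply: C_ext => /=; ring. Qed.
Lemma CaddC : commutative Cadd.
Proof. by move=> x y; apply: C_ext => /=; ring. Qed.
Lemma Cadd0 : left_id Czero Cadd.
Proof. by move=> x; apply: C_ext => /=; ring. Qed.
Lemma CaddN : left_inverse Czero Copp Cadd.
Proof. by move=> x; apply: C_ext => /=; ring. Qed.

HB.instance Definition _ := GRing.isZmodule.Build Cplx CaddA CaddC Cadd0 CaddN.

Lemma CmulA : associative Cmul.
Proof. by move=> x y z; apply: C_ext => /=; ring. Qed.
Lemma CmulC : commutative Cmul.
Proof. by move=> x y; apply: C_ext => /=; ring. Qed.
Lemma Cmul1 : left_id Cone Cmul.
Proof. by move=> x; apply: C_ext => /=; ring. Qed.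
Lemma CmulDl : left_distributive Cmul Cadd.
Proof. by move=> x y z; apply: C_ext => /=; ring. Qed.
Lemma Cone_neq0 : Cone != Czero.
Proof.
apply/eqP => h; have := f_equal cre h => /=; lra.
Qed.

HB.instance Definition _ :=
  GRing.Zmodule_isComNzRing.Build Cplx CmulA CmulC Cmul1 CmulDl Cone_neq0.

Lemma CmulVf (x : Cplx) : x != 0%R -> Cmul (Cinv x) x = Cone.
Proof.
case: x => a b /= hx.
have hn : a ^ 2 + b ^ 2 <> 0.
  move=> h; move/eqP: hx; apply; apply: C_ext => /=; nra.
have hn' : a * a + b * b <> 0 by move=> h; apply: hn; rewrite -h; ring.
by apply: C_ext => /=; field.
Qed.
Lemma Cinv0 : Cinv 0%R = 0%R.
Proof.
by apply: C_ext; rewrite /= /Rdiv; ring.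
Qed.

HB.instance Definition _ := GRing.ComNzRing_isField.Build Cplx CmulVf Cinv0.
Close Scope R_scope.

Local Open Scope ring_scope.

Definition ctr (m n : nat) (A : 'M[Cplx]_(m, n)) : 'M[Cplx]_(n, m) := (map_mx Cconj A)^T.

Definition psd (n : nat) (A : 'M[Cplx]_n) : Prop :=
  A = ctr A /\ forall x : 'cV[Cplx]_n, Rle R0 (cre ((ctr x *m A *m x) ord0 ord0)).

Definition cnorm2 (n : nat) (v : 'cV[Cplx]_n) : R := cre ((ctr v *m v) ord0 ord0).

Definition gain (m n : nat) (r : 'cV[Cplx]_m) (H : 'M[Cplx]_(m, n)) (t : 'cV[Cplx]_n) : R :=
  Cabs2 ((ctr r *m H *m t) ord0 ord0).

Definition Rsum (n : nat) (f : 'I_n -> R) : R := \big[Rplus/R0]_(i < n) f i.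

Section BMAC.
Variables (L : nat) (LT LR : 'I_L -> nat)
  (H : forall l k : 'I_L, 'M[Cplx]_(LR l, LT k)) (Phi : 'I_L -> 'I_L -> bool).

Definition Omega (Sigma : forall k : 'I_L, 'M[Cplx]_(LT k)) (l : 'I_L) : 'M[Cplx]_(LR l) :=
  1%:M + \sum_(k < L | Phi l k) (H l k *m Sigma k *m ctr (H l k)).

Definition rate (Sigma : forall k : 'I_L, 'M[Cplx]_(LT k)) (l : 'I_L) : R :=
  ln (Cmod (\det (1%:M + H l l *m Sigma l *m ctr (H l l) *m invmx (Omega Sigma l)))).

Definition nstreams (l : 'I_L) : nat := \rank (H l l).

Definition TxVecs := forall (l : 'I_L), 'I_(nstreams l) -> 'cV[Cplx]_(LT l).
Definition RxVecs := forall (l : 'I_L), 'I_(nstreams l) -> 'cV[Cplx]_(LR l).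
Definition Powers := forall (l : 'I_L), 'I_(nstreams l) -> R.

Definition Psi (T : TxVecs) (Rv : RxVecs) (l : 'I_L) (m : 'I_(nstreams l))
    (k : 'I_L) (n : 'I_(nstreams k)) : R :=
  if k == l then (if (m < n)%N then gain (Rv l m) (H l k) (T k n) else R0)
  else (if Phi l k then gain (Rv l m) (H l k) (T k n) else R0).

Definition sinr (T : TxVecs) (Rv : RxVecs) (p : Powers) (l : 'I_L)
    (m : 'I_(nstreams l)) : R :=
  Rdiv (Rmult (p l m) (gain (Rv l m) (H l l) (T l m)))
    (Rplus R1 (Rsum (fun k => Rsum (fun n : 'I_(nstreams k) =>
                                      Rmult (p k n) (Psi T Rv m n))))).
End BMAC.

(* For a max-min problem  max_{x feasible} min_{i} obj x i  (i ranging over a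
   finite index type), "the optimal value is at least 1", i.e.
   sup_{x feasible} min_i obj x i >= 1, written out:
   for every eps > 0 some feasible x has min_i obj x i > 1 - eps. *)
Definition maxmin_value_ge1 (X I : Type) (feasible : X -> Prop) (obj : X -> I -> R)
  : Prop :=
  forall eps : R, Rlt R0 eps ->
    exists x, feasible x /\ forall i : I, Rlt (Rminus R1 eps) (obj x i).

(* Main.v *)
(** FOP to EFOP: given near-optimal covariances, shrink each one to [C C^*] with
    [\rank (H l l)] columns, without changing the useful signal [H C C^* H^*]; this
    lowers the power and the interference, so no rate decreases.  Since
    [(C V) (C V)^* = C C^*] for every unitary [V], the streams may be rotated freely.
    The rate of a link is the log-determinant ratio of its received covariances with
    and without its own signal, and this ratio factors along the successive
    cancellation into the terms [1 + SINR] of the MMSE receivers.  A rotation making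
    all these factors equal is built one stream at a time: if [G] is positive definite
    with [\det G = d ^ M], the quadratic form of [G] takes the value [d] on some unit
    vector.  EFOP to FOP: no receiver beats MMSE, so the rate of [\sum p t t^*] is at
    least [\sum ln (1 + SINR)].  Convexity of [exp] converts between relative errors
    in rates and in SINRs. *)

Require Import Defs.
From Stdlib Require Import Reals Lra Psatz Classical ClassicalEpsilon.
From HB Require Import structures.
From mathcomp Require Import all_boot all_order all_algebra.

Set Implicit Arguments. Unset Strict Implicit. Unset Printing Implicit Defensive.
Import GRing.Theory.
Delimit Scope R_scope with Re.
Local Open Scope ring_scope.

(** * Complex scalars *)

Lemma creD (x y : Cplx) : cre (x + y) = (cre x + cre y)%Re. Proof. by []. Qed.
Lemma cimD (x y : Cplx) : cim (x + y) = (cim x + cim y)%Re. Proof. by []. Qed.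
Lemma creN (x : Cplx) : cre (- x) = (- cre x)%Re. Proof. by []. Qed.
Lemma cimN (x : Cplx) : cim (- x) = (- cim x)%Re. Proof. by []. Qed.
Lemma creM (x y : Cplx) : cre (x * y) = (cre x * cre y - cim x * cim y)%Re.
Proof. by []. Qed.
Lemma cimM (x y : Cplx) : cim (x * y) = (cre x * cim y + cim x * cre y)%Re.
Proof. by []. Qed.
Lemma cre1 : cre 1 = R1. Proof. by []. Qed.
Lemma cim1 : cim 1 = R0. Proof. by []. Qed.
Definition CplxE := (creD, cimD, creN, cimN, creM, cimM, cre1, cim1).

Ltac cplx := apply: C_ext; rewrite ?CplxE /= ?CplxE /=; ring.

Lemma RtoC0 : RtoC 0 = 0. Proof. by []. Qed.
Lemma RtoC1 : RtoC 1 = 1. Proof. by []. Qed.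
Lemma RtoCD a b : RtoC (a + b) = RtoC a + RtoC b. Proof. cplx. Qed.
Lemma RtoCM a b : RtoC (a * b) = RtoC a * RtoC b. Proof. cplx. Qed.
Lemma RtoCX a n : RtoC (a ^ n)%Re = RtoC a ^+ n.
Proof. by elim: n => [|n IH] //=; rewrite RtoCM IH exprS. Qed.
Lemma RtoC_inj : injective RtoC. Proof. by move=> a b []. Qed.

Lemma cre_sum (I : Type) (r : seq I) (P : pred I) (F : I -> Cplx) :
  cre (\sum_(i <- r | P i) F i) = \big[Rplus/R0]_(i <- r | P i) cre (F i).
Proof. exact: (big_morph cre). Qed.

Lemma cre_scale a z : cre (RtoC a * z) = (a * cre z)%Re.
Proof. by rewrite creM /=; ring. Qed.

(** Registering conjugation as a ring morphism lets the conjugate transpose inherit the algebra of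
    [map_mx]. *)
Lemma Cconj_zmod : zmod_morphism Cconj. Proof. by move=> x y; cplx. Qed.
Lemma Cconj_monoid : monoid_morphism Cconj.
Proof. by split=> [|x y]; cplx. Qed.
HB.instance Definition _ := GRing.isZmodMorphism.Build Cplx Cplx Cconj Cconj_zmod.
HB.instance Definition _ := GRing.isMonoidMorphism.Build Cplx Cplx Cconj Cconj_monoid.

Lemma CconjM x y : Cconj (x * y) = Cconj x * Cconj y.
Proof. exact: rmorphM. Qed.
Lemma CconjK : involutive Cconj. Proof. by move=> x; cplx. Qed.
Lemma Cconj_RtoC a : Cconj (RtoC a) = RtoC a. Proof. cplx. Qed.
Lemma Cconj_real z : Cconj z = z -> z = RtoC (cre z).
Proof. by move/(f_equal cim) => /= h; apply: C_ext => //=; lra. Qed.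
Lemma mulCconj z : Cconj z * z = RtoC (Cabs2 z).
Proof. by rewrite /Cabs2; cplx. Qed.

Lemma Cabs2_ge0 z : (0 <= Cabs2 z)%Re.
Proof. rewrite /Cabs2; nra. Qed.
Lemma Cabs2_gt0 z : z != 0 -> (0 < Cabs2 z)%Re.
Proof.
move=> /eqP hz; case: (Rle_lt_or_eq_dec _ _ (Cabs2_ge0 z)) => // h.
by case: hz; apply: C_ext; rewrite /=; move: h; rewrite /Cabs2; nra.
Qed.
Lemma Cabs2M x y : Cabs2 (x * y) = (Cabs2 x * Cabs2 y)%Re.
Proof. by rewrite /Cabs2 !CplxE; ring. Qed.
Lemma Cabs2_RtoC a : Cabs2 (RtoC a) = (a * a)%Re.
Proof. by rewrite /Cabs2 /=; ring. Qed.
Lemma Cabs2_conj z : Cabs2 (Cconj z) = Cabs2 z.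
Proof. by rewrite /Cabs2 /=; ring. Qed.

(** * Hermitian forms *)

Lemma ctrE m n (A : 'M[Cplx]_(m, n)) i j : ctr A i j = Cconj (A j i).
Proof. by rewrite /ctr !mxE. Qed.
Lemma ctrK m n : cancel (@ctr m n) (@ctr n m).
Proof. by move=> A; apply/matrixP => i j; rewrite !ctrE CconjK. Qed.
Lemma ctrM m n p (A : 'M[Cplx]_(m, n)) (B : 'M[Cplx]_(n, p)) :
  ctr (A *m B) = ctr B *m ctr A.
Proof. by rewrite /ctr map_mxM trmx_mul. Qed.
Lemma ctrD m n (A B : 'M[Cplx]_(m, n)) : ctr (A + B) = ctr A + ctr B.
Proof. by rewrite /ctr map_mxD linearD. Qed.
Lemma ctrN m n (A : 'M[Cplx]_(m, n)) : ctr (- A) = - ctr A.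
Proof. by rewrite /ctr map_mxN linearN. Qed.
Lemma ctr0 m n : ctr (0 : 'M[Cplx]_(m, n)) = 0.
Proof. by rewrite /ctr map_mx0 trmx0. Qed.
Lemma ctrZ m n c (A : 'M[Cplx]_(m, n)) : ctr (c *: A) = Cconj c *: ctr A.
Proof. by rewrite /ctr map_mxZ linearZ. Qed.
Lemma ctr_scalar n c : ctr (c%:M : 'M[Cplx]_n) = (Cconj c)%:M.
Proof. by rewrite /ctr map_scalar_mx tr_scalar_mx. Qed.
Lemma ctr1 n : ctr (1%:M : 'M[Cplx]_n) = 1%:M.
Proof. by rewrite ctr_scalar rmorph1. Qed.
Lemma ctr_invmx n (A : 'M[Cplx]_n) : ctr (invmx A) = invmx (ctr A).
Proof. by rewrite /ctr map_invmx trmx_inv. Qed.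
Lemma ctr_row_mx m n1 n2 (A : 'M[Cplx]_(m, n1)) (B : 'M[Cplx]_(m, n2)) :
  ctr (row_mx A B) = col_mx (ctr A) (ctr B).
Proof. by rewrite /ctr map_row_mx tr_row_mx. Qed.
Lemma row_mx_gram m n1 n2 (A : 'M[Cplx]_(m, n1)) (B : 'M[Cplx]_(m, n2)) :
  row_mx A B *m ctr (row_mx A B) = A *m ctr A + B *m ctr B.
Proof. by rewrite ctr_row_mx mul_row_col. Qed.

Lemma gram_split m n1 n2 (B : 'M[Cplx]_(m, n1 + n2)) :
  B *m ctr B = lsubmx B *m ctr (lsubmx B) + rsubmx B *m ctr (rsubmx B).
Proof. by rewrite -row_mx_gram hsubmxK. Qed.

Definition hform n (A : 'M[Cplx]_n) (x y : 'cV[Cplx]_n) : Cplx :=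
  (ctr x *m A *m y) ord0 ord0.

Section Form.
Variables (n : nat) (A : 'M[Cplx]_n).
Implicit Types x y z : 'cV[Cplx]_n.

Lemma hformDl x y z : hform A (x + y) z = hform A x z + hform A y z.
Proof. by rewrite /hform ctrD !mulmxDl mxE. Qed.
Lemma hformDr x y z : hform A x (y + z) = hform A x y + hform A x z.
Proof. by rewrite /hform mulmxDr mxE. Qed.
Lemma hformZl c x y : hform A (c *: x) y = Cconj c * hform A x y.
Proof. by rewrite /hform ctrZ -!scalemxAl mxE. Qed.
Lemma hformZr c x y : hform A x (c *: y) = c * hform A x y.
Proof. by rewrite /hform -scalemxAr mxE. Qed.
Lemma hformD B x y : hform (A + B) x y = hform A x y + hform B x y.
Proof. by rewrite /hform mulmxDr mulmxDl mxE. Qed.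
Lemma hformN x y : hform (- A) x y = - hform A x y.
Proof. by rewrite /hform mulmxN mulNmx mxE. Qed.
Lemma hform_ctr x y : hform (ctr A) x y = Cconj (hform A y x).
Proof. by rewrite /hform -ctrE !ctrM ctrK mulmxA. Qed.
Lemma hform_hermC x y : A = ctr A -> hform A y x = Cconj (hform A x y).
Proof. by move=> hA; rewrite -hform_ctr -hA. Qed.
Lemma hform_herm_real x : A = ctr A -> hform A x x = RtoC (cre (hform A x x)).
Proof. by move=> hA; apply: Cconj_real; rewrite -hform_hermC. Qed.
End Form.

Lemma hform_scalar n a (x : 'cV[Cplx]_n) :
  hform (RtoC a)%:M x x = RtoC (a * cnorm2 x).
Proof.
rewrite /hform mul_mx_scalar -scalemxAl mxE RtoCM /cnorm2; congr (_ * _).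
have := @hform_herm_real n 1%:M x; rewrite /hform mulmx1 => -> //.
by rewrite ctr1.
Qed.
Lemma hform1 n (x : 'cV[Cplx]_n) : hform 1%:M x x = RtoC (cnorm2 x).
Proof. by rewrite -RtoC1 hform_scalar; congr RtoC; ring. Qed.

Lemma hform_congr m n (A : 'M[Cplx]_m) (B : 'M[Cplx]_(m, n)) (x y : 'cV[Cplx]_n) :
  hform (ctr B *m A *m B) x y = hform A (B *m x) (B *m y).
Proof. by rewrite /hform ctrM !mulmxA. Qed.

Lemma hform_rank1 n (b x : 'cV[Cplx]_n) :
  hform (b *m ctr b) x x = RtoC (Cabs2 ((ctr x *m b) ord0 ord0)).
Proof.
have -> : hform (b *m ctr b) x x = ((ctr x *m b) *m ctr (ctr x *m b)) ord0 ord0.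
  by rewrite /hform ctrM ctrK !mulmxA.
by rewrite mxE big_ord1 ctrE mulrC mulCconj.
Qed.

Lemma cnorm2E n (x : 'cV[Cplx]_n) : cnorm2 x = Rsum (fun i => Cabs2 (x i ord0)).
Proof.
rewrite /cnorm2 mxE cre_sum; apply: eq_bigr => i _.
by rewrite ctrE mulCconj.
Qed.

Lemma Rsum_ge0 n (f : 'I_n -> R) : (forall i, (0 <= f i)%Re) -> (0 <= Rsum f)%Re.
Proof.
move=> h; apply: (big_ind (Rle 0)) => [|x y hx hy|//]; first exact: Rle_refl.
by lra.
Qed.

Lemma Rsum_le n (f g : 'I_n -> R) :
  (forall i, (f i <= g i)%Re) -> (Rsum f <= Rsum g)%Re.
Proof.
move=> h; apply: (big_ind2 Rle) => [|x y z t hx hy|//]; first exact: Rle_refl.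
by lra.
Qed.

Lemma Rsum_term n (f : 'I_n -> R) i :
  (forall j, (0 <= f j)%Re) -> (f i <= Rsum f)%Re.
Proof.
elim: n f i => [f [] //|n IH] f i h; rewrite /Rsum big_ord_recl.
have := Rsum_ge0 (fun j => h (lift ord0 j)); rewrite /Rsum => h1.
set S := \big[Rplus/R0]_(_ < _) _ in h1 *.

case: (unliftP ord0 i) => [j ->|->]; last by lra.
have h2 : (f (lift ord0 j) <= S)%Re := IH (fun j => f (lift ord0 j)) j (fun j => h _).
have := h ord0; lra.
Qed.

Lemma cnorm2_ge0 n (x : 'cV[Cplx]_n) : (0 <= cnorm2 x)%Re.
Proof. by rewrite cnorm2E; apply: Rsum_ge0 => i; apply: Cabs2_ge0. Qed.

Lemma cnorm2_gt0 n (x : 'cV[Cplx]_n) : x != 0 -> (0 < cnorm2 x)%Re.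
Proof.
move=> hx; case: (Rle_lt_or_eq_dec _ _ (cnorm2_ge0 x)) => // h0.
case/eqP: hx; apply/colP => i; rewrite mxE; apply/eqP.
apply: contraT => /Cabs2_gt0 hi.
have := @Rsum_term _ (fun i => Cabs2 (x i ord0)) i (fun j => Cabs2_ge0 _).
by rewrite -cnorm2E -h0 => h; move: (Rlt_not_le _ _ hi).
Qed.

Lemma cnorm2Z n c (x : 'cV[Cplx]_n) : cnorm2 (c *: x) = (Cabs2 c * cnorm2 x)%Re.
Proof.
apply: RtoC_inj; rewrite -hform1 hformZl hformZr hform1 mulrA mulCconj.
by rewrite RtoCM.
Qed.

(** * Positive (semi)definite matrices *)

Definition posdef n (A : 'M[Cplx]_n) : Prop :=
  A = ctr A /\ forall x : 'cV[Cplx]_n, x != 0 -> (0 < cre (hform A x x))%Re.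

Lemma posdef_psd n (A : 'M[Cplx]_n) : posdef A -> psd A.
Proof.
case=> hA hp; split=> // x; have [->|/hp] := eqVneq x 0; last exact: Rlt_le.
by rewrite mulmx0 mxE; apply: Rle_refl.
Qed.

Lemma posdef1 n : posdef (1%:M : 'M[Cplx]_n).
Proof. by split=> [|x hx]; rewrite ?ctr1 // hform1; apply: cnorm2_gt0. Qed.

Lemma posdefD n (A B : 'M[Cplx]_n) : posdef A -> psd B -> posdef (A + B).
Proof.
move=> [hA pA] [hB pB]; split=> [|x hx]; first by rewrite ctrD -hA -hB.
by rewrite hformD creD; have := pA _ hx; have := pB x; rewrite /hform; lra.
Qed.

Lemma psdD n (A B : 'M[Cplx]_n) : psd A -> psd B -> psd (A + B).
Proof.
move=> [hA pA] [hB pB]; split=> [|x]; first by rewrite ctrD -hA -hB.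
rewrite -[X in cre X]/(hform _ _ _) hformD creD.
by have := pA x; have := pB x; rewrite /hform; lra.
Qed.

Lemma psd0 n : psd (0 : 'M[Cplx]_n).
Proof.
by split=> [|x]; rewrite ?ctr0 // mulmx0 mul0mx mxE; apply: Rle_refl.
Qed.

Lemma psd_sum n (I : Type) (r : seq I) (P : pred I) (F : I -> 'M[Cplx]_n) :
  (forall i, psd (F i)) -> psd (\sum_(i <- r | P i) F i).
Proof. by move=> h; elim/big_ind: _ => //; [exact: psd0|exact: psdD]. Qed.

Lemma psd_congr m n (A : 'M[Cplx]_m) (B : 'M[Cplx]_(n, m)) :
  psd A -> psd (B *m A *m ctr B).
Proof.
move=> [hA pA]; split=> [|x]; first by rewrite !ctrM ctrK -hA mulmxA.
by have := pA (ctr B *m x); rewrite ctrM ctrK !mulmxA.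
Qed.

Lemma psd_gram m n (B : 'M[Cplx]_(n, m)) : psd (B *m ctr B).
Proof. by have := psd_congr B (posdef_psd (posdef1 m)); rewrite mulmx1. Qed.

(** A kernel vector would give the form the value zero. The transposes are there because [det0P]
    yields a row vector killed on the left. *)
Lemma posdef_unit n (A : 'M[Cplx]_n) : posdef A -> A \in unitmx.
Proof.
move=> [hA pA]; rewrite unitmxE unitfE; apply/negP => /eqP.
rewrite -det_tr => /eqP/det0P [v hv hv0].
have: v^T != 0 by rewrite -[0]trmx0 (inj_eq trmx_inj).
move/pA; rewrite /hform -mulmxA.
have ->: A *m v^T = 0 by rewrite -[A]trmxK -trmx_mul hv0 trmx0.
by rewrite mulmx0 mxE => /Rlt_irrefl.
Qed.

Lemma hform_invmx n (A : 'M[Cplx]_n) (b : 'cV[Cplx]_n) : posdef A ->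
  hform (invmx A) b b = hform A (invmx A *m b) (invmx A *m b).
Proof.
move=> pA; have uA := posdef_unit pA; rewrite -hform_congr.
by rewrite ctr_invmx -pA.1 mulVmx // mul1mx.
Qed.

Lemma posdef_invmx n (A : 'M[Cplx]_n) : posdef A -> posdef (invmx A).
Proof.
move=> pA; have uA := posdef_unit pA; split=> [|x hx].
  by rewrite ctr_invmx -pA.1.
rewrite hform_invmx //; apply: pA.2; apply: contraNneq hx => h.
by rewrite -[x](mulKVmx uA) h mulmx0.
Qed.

(** The form is nonnegative at [x] plus a multiple of [y]. Choosing the phase of the multiplier so
    that the cross term is real leaves a real quadratic in [s], whose minimum gives the bound. *)
Lemma psd_cauchy_schwarz n (A : 'M[Cplx]_n) (x y : 'cV[Cplx]_n) : psd A ->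
  (Cabs2 (hform A x y) <= cre (hform A x x) * cre (hform A y y))%Re.
Proof.
move=> [hA pA].
set a := cre (hform A x x); set c := cre (hform A y y); set q := Cabs2 _.
have ha : (0 <= a)%Re := pA x.
have hc : (0 <= c)%Re := pA y.
have hq : (0 <= q)%Re := Cabs2_ge0 _.
have key (s : R) : (0 <= a + 2 * s * q + s * s * q * c)%Re.
  have := pA (x + (RtoC s * Cconj (hform A x y)) *: y).
  rewrite -[X in cre X]/(hform _ _ _) !hformDl !hformDr !hformZl !hformZr.
  rewrite (hform_hermC x y hA) (hform_herm_real x hA) (hform_herm_real y hA).
  rewrite -/a -/c CconjM Cconj_RtoC CconjK /q /Cabs2 !CplxE /=.
  by set u := cre _; set v := cim _ => h; apply: (Rle_trans _ _ _ h); right; ring.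
case: (Rle_lt_or_eq_dec _ _ hc) => [c0|c0].
  (* [s = - / c] minimizes the quadratic. *)
  have h := key (- / c)%Re; have e : (c * / c = 1)%Re by field; lra.
  have : (a + 2 * - / c * q + - / c * - / c * q * c = a - q * / c)%Re by field; lra.
  move=> e2; rewrite e2 in h; have h3 := Rmult_le_compat_r c _ _ hc h.
  have : ((a - q * / c) * c = a * c - q)%Re by field; lra.
  by lra.
rewrite -c0; case: (Rle_lt_or_eq_dec _ _ hq) => [q0|]; last by lra.
(* With [c = 0] the expression is affine in [s], and this [s] gives it the value [-1], a
   contradiction. *)
have := key (- (a + 1) / (2 * q))%Re; rewrite -c0.
have -> : (2 * (- (a + 1) / (2 * q)) * q = - (a + 1))%Re by field; lra.
by lra.
Qed.

(** * Determinants of Gram updates *)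

(** The same two block matrices, multiplied in either order, give block triangular products with
    these two determinants. *)
Lemma det_sylvester m n (A : 'M[Cplx]_(m, n)) (B : 'M[Cplx]_(n, m)) :
  \det (1%:M + A *m B) = \det (1%:M + B *m A).
Proof.
have e1 : block_mx 1%:M (- A) B 1%:M *m block_mx 1%:M A 0 1%:M
          = block_mx 1%:M 0 B (1%:M + B *m A).
  by rewrite mulmx_block !(mulmx1, mul1mx, mulmx0) !addr0 subrr addrC.
have e2 : block_mx 1%:M A 0 1%:M *m block_mx 1%:M (- A) B 1%:M
          = block_mx (1%:M + A *m B) 0 B 1%:M.
  by rewrite mulmx_block !(mulmx1, mul1mx, mul0mx) !add0r addNr.
have := congr1 determinant e1; have := congr1 determinant e2.
by rewrite !det_mulmx !det_lblock !det_ublock !det1 !mulr1 !mul1r => -> ->.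
Qed.

Lemma det_update m n (K : 'M[Cplx]_n) (B : 'M[Cplx]_(n, m)) : posdef K ->
  \det (K + B *m ctr B) = \det (1%:M + ctr B *m invmx K *m B) * \det K.
Proof.
move=> /posdef_unit uK.
have -> : K + B *m ctr B = K *m (1%:M + invmx K *m B *m ctr B).
  by rewrite mulmxDr mulmx1 -!mulmxA mulKVmx.
by rewrite det_mulmx (det_sylvester (invmx K *m B)) mulrC mulmxA.
Qed.

(* The signal-to-noise ratio of the linear MMSE receiver for the signal [b] in
   noise of covariance [K]. *)
Definition mmse n (K : 'M[Cplx]_n) (b : 'cV[Cplx]_n) : R :=
  cre (hform (invmx K) b b).

Lemma mmseE n (K : 'M[Cplx]_n) b : posdef K -> hform (invmx K) b b = RtoC (mmse K b).
Proof. by move=> /posdef_invmx [h _]; apply: hform_herm_real. Qed.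

Lemma mmse_ge0 n (K : 'M[Cplx]_n) b : posdef K -> (0 <= mmse K b)%Re.
Proof. by move=> /posdef_invmx/posdef_psd [_ h]; apply: h. Qed.

Lemma det_rank1_update n (K : 'M[Cplx]_n) (b : 'cV[Cplx]_n) : posdef K ->
  \det (K + b *m ctr b) = RtoC (1 + mmse K b) * \det K.
Proof.
move=> pK; rewrite det_update // det_mx11 mxE [1%:M _ _]mxE /= RtoCD -mmseE //.
Qed.

(* Cauchy-Schwarz for [K] applied to [r] and [K^-1 b]: no receiver beats MMSE. *)
Lemma mmse_optimal n (K : 'M[Cplx]_n) (b r : 'cV[Cplx]_n) : posdef K ->
  (Cabs2 ((ctr r *m b) ord0 ord0) <= cre (hform K r r) * mmse K b)%Re.
Proof.
move=> pK; have := psd_cauchy_schwarz r (invmx K *m b) (posdef_psd pK).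
by rewrite -hform_invmx // {1}/hform -mulmxA mulKVmx // posdef_unit.
Qed.

(** The receiver that is optimal in the larger noise [K] is used in the smaller noise [K'], where it
    sees no more noise and still cannot beat the MMSE receiver. *)
Lemma mmse_anti n (K K' : 'M[Cplx]_n) (b : 'cV[Cplx]_n) :
  posdef K -> posdef K' -> psd (K - K') -> (mmse K b <= mmse K' b)%Re.
Proof.
move=> pK pK' [_ hd].
have h := mmse_optimal b (invmx K *m b) pK'.
have e : (ctr (invmx K *m b) *m b) ord0 ord0 = RtoC (mmse K b).
  by rewrite ctrM ctr_invmx -pK.1 -mmseE.
have := hd (invmx K *m b); rewrite -[X in cre X]/(hform _ _ _) hformD hformN.
rewrite -hform_invmx // creD creN -/(mmse K b) => h2.
move: h; rewrite e Cabs2_RtoC => h.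
have p0 := mmse_ge0 b pK; have p0' := mmse_ge0 b pK'.
(* The square of [mmse K b] is at most [mmse K b * mmse K' b]; one factor cancels unless it is zero,
   and then the claim is trivial. *)
case: (Rle_lt_or_eq_dec _ _ p0) => [p1|<- //].
apply: (Rmult_le_reg_l (mmse K b)) => //; apply: (Rle_trans _ _ _ h).
apply: Rmult_le_compat_r => //.
by change R0 with 0%Re in h2; lra.
Qed.

(** Adding the columns of [B] one at a time multiplies each determinant by a factor [1 + mmse], and
    every factor is larger in the smaller noise [K']. The difference of the two noises stays the
    same along the way. *)
Lemma det_ratio_anti n M (B : 'M[Cplx]_(n, M)) (K K' : 'M[Cplx]_n) :
  posdef K -> posdef K' -> psd (K - K') ->
  exists rho rho' : R, [/\ (1 <= rho <= rho')%Re,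
    \det (K + B *m ctr B) = RtoC rho * \det K &
    \det (K' + B *m ctr B) = RtoC rho' * \det K'].
Proof.
elim: M B K K' => [B K K' _ _ _|M IH B K K' pK pK' hd].
  exists R1, R1; rewrite (flatmx0 (ctr B)) !mulmx0 !addr0 RtoC1 !mul1r; split=> //.
  by lra.
rewrite (@gram_split n 1 M B) !addrA.
set b := @lsubmx _ n 1 M B; set B' := @rsubmx _ n 1 M B.
have gb := psd_gram b.
have [|||r [r' [hr -> ->]]] := IH B' (K + b *m ctr b) (K' + b *m ctr b).
- exact: posdefD.
- exact: posdefD.
- by rewrite opprD addrACA subrr addr0.
rewrite !det_rank1_update // !mulrA -!RtoCM.
exists (r * (1 + mmse K b))%Re, (r' * (1 + mmse K' b))%Re; split=> //.
have := mmse_anti b pK pK' hd; have := mmse_ge0 b pK; nra.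
Qed.

Lemma det_ratio_ge1 n M (B : 'M[Cplx]_(n, M)) (K : 'M[Cplx]_n) : posdef K ->
  exists2 rho : R, (1 <= rho)%Re & \det (K + B *m ctr B) = RtoC rho * \det K.
Proof.
move=> pK; have [|r [r' [h e _]]] := @det_ratio_anti n M B _ _ pK pK.
  by rewrite subrr; apply: psd0.
by exists r => //; lra.
Qed.

(** The first nonzero column contributes a factor above 1, and the later ones contribute at least
    1. *)
Lemma det_ratio_gt1 n M (B : 'M[Cplx]_(n, M)) (K : 'M[Cplx]_n) : posdef K ->
  B *m ctr B != 0 ->
  exists2 rho : R, (1 < rho)%Re & \det (K + B *m ctr B) = RtoC rho * \det K.
Proof.
elim: M B K => [B K _|M IH B K pK]; first by rewrite (flatmx0 (ctr B)) mulmx0 eqxx.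
rewrite (@gram_split n 1 M B) !addrA.
set b := @lsubmx _ n 1 M B; set B' := @rsubmx _ n 1 M B => hB.
have [b0|b0] := eqVneq b 0.
  by move: hB; rewrite b0 mul0mx addr0 add0r; apply: IH.
have pK1 : posdef (K + b *m ctr b) by apply: posdefD => //; apply: psd_gram.
have [r hr ->] := det_ratio_ge1 B' pK1.
rewrite det_rank1_update // mulrA -RtoCM.
exists (r * (1 + mmse K b))%Re => //.
have : (0 < mmse K b)%Re := (posdef_invmx pK).2 _ b0.
by nra.
Qed.

(** * Determinant ratios along successive cancellation *)

Definition prefix_gram n M (B : 'M[Cplx]_(n, M)) (m : 'I_M) : 'M[Cplx]_n :=
  \sum_(j < M | (j < m)%N) col j B *m ctr (col j B).

Lemma psd_prefix_gram n M (B : 'M[Cplx]_(n, M)) m : psd (prefix_gram B m).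
Proof. by apply: psd_sum => j; apply: psd_gram. Qed.

Lemma col_first n M (B : 'M[Cplx]_(n, 1 + M)) : col ord0 B = lsubmx B.
Proof. by apply/colP => i; rewrite !mxE; congr (B _ _); apply: val_inj. Qed.

Lemma col_lift n M (B : 'M[Cplx]_(n, 1 + M)) j :
  col (lift ord0 j) B = col j (rsubmx B).
Proof. by apply/colP => i; rewrite !mxE; congr (B _ _); apply: val_inj. Qed.

Lemma prefix_gram0 n M (B : 'M[Cplx]_(n, 1 + M)) : prefix_gram B ord0 = 0.
Proof. by rewrite /prefix_gram big_pred0. Qed.

Lemma prefix_gram_lift n M (B : 'M[Cplx]_(n, 1 + M)) m :
  prefix_gram B (lift ord0 m)
  = lsubmx B *m ctr (lsubmx B) + prefix_gram (rsubmx B) m.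
Proof.
rewrite /prefix_gram big_mkcond big_ord_recl [in RHS]big_mkcond /=.
rewrite col_first; congr (_ + _); apply: eq_bigr => j _.
by rewrite col_lift /bump !add1n ltnS.
Qed.

(** The ratio telescopes into the product of the factors [1 + mmse]. Absorbing the first column into
    [K] turns the prefix noises of [B] into those of the remaining columns. *)
Lemma det_ratio_chain n M (B : 'M[Cplx]_(n, M)) (K : 'M[Cplx]_n) (c : R) :
  posdef K -> (0 <= c)%Re ->
  (forall m, (c <= 1 + mmse (K + prefix_gram B m) (col m B))%Re) ->
  exists2 rho : R, (c ^ M <= rho)%Re &
    \det (K + B *m ctr B) = RtoC rho * \det K.
Proof.
move=> + c0; elim: M B K => [B K _ _|M IH B K pK hB].
  exists R1; first by right.
  by rewrite (flatmx0 (ctr B)) !mulmx0 !addr0 RtoC1 !mul1r.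
rewrite (@gram_split n 1 M B) addrA.
set b := @lsubmx _ n 1 M B; set B' := @rsubmx _ n 1 M B.
have pK1 : posdef (K + b *m ctr b) by apply: posdefD => //; apply: psd_gram.
have [|r hr ->] := IH B' _ pK1.
  move=> m; have := hB (lift ord0 m).
  by rewrite (@prefix_gram_lift n M B) (@col_lift n M B) addrA.
rewrite det_rank1_update // mulrA -RtoCM.
exists (r * (1 + mmse K b))%Re => //.
have := hB ord0; rewrite (@prefix_gram0 n M B) addr0 (@col_first n M B) => h1.
have h2 := pow_le _ M c0.
by rewrite /= Rmult_comm; apply: Rmult_le_compat.
Qed.

(** * Factorizations and rotations *)

(** Cholesky elimination from the last index downwards: [k] bounds the rows that may be nonzero, and
    each step clears the last of them with one column of the factor. *)
Lemma psd_factor n k (A : 'M[Cplx]_n) : psd A ->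
  (forall i j : 'I_n, (k <= i)%N -> A i j = 0) ->
  exists B : 'M[Cplx]_(n, k), A = B *m ctr B.
Proof.
elim: k A => [A _ hA|k IH A pA hA].
  by exists 0; apply/matrixP => i j; rewrite mul0mx mxE hA.
(* If the row to clear is already zero or lies outside the matrix, a zero column is prepended. *)
have pad : (forall i j : 'I_n, (k <= i)%N -> A i j = 0) ->
    exists B : 'M[Cplx]_(n, k.+1), A = B *m ctr B.
  move=> /(IH A pA) [B eB]; exists (row_mx (0 : 'cV_n) B : 'M_(n, 1 + k)).
  by rewrite (@row_mx_gram n 1 k) mul0mx add0r.
case: (ltnP k n) => [kn|nk]; last first.
  by apply: pad => i j ki; have := leq_trans (ltn_ord i) (leq_trans nk ki); rewrite ltnn.
pose i0 := Ordinal kn; pose e : 'cV[Cplx]_n := delta_mx i0 ord0.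
have he x : hform A x e = (ctr x *m col i0 A) ord0 ord0.
  by rewrite /hform -mulmxA -colE.
have hee : hform A e e = A i0 i0.
  by rewrite he /ctr map_delta_mx trmx_delta -rowE !mxE.
set al := cre (A i0 i0); have al0 : (0 <= al)%Re by rewrite /al -hee; apply: pA.2.
have hal : A i0 i0 = RtoC al by rewrite /al -hee; apply: hform_herm_real; apply: pA.1.
have hconj i j : A i j = Cconj (A j i) by rewrite {1}pA.1 ctrE.
case: (Rle_lt_or_eq_dec _ _ al0) => [al1|al_eq0]; last first.
  apply: pad => i j; rewrite leq_eqVlt => /orP [/eqP ki|/hA //].
  have -> : i = i0 by apply: val_inj.
  (* By Cauchy-Schwarz, a zero diagonal entry forces its whole row to vanish. *)
  apply/eqP; apply: contraT => /Cabs2_gt0 hj.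
  have := psd_cauchy_schwarz (delta_mx j ord0) e pA.
  rewrite hee -/al -al_eq0 Rmult_0_r he /ctr map_delta_mx trmx_delta -rowE !mxE.
  by rewrite hconj Cabs2_conj => /(Rlt_le_trans _ _ _ hj)/Rlt_irrefl.
have [sq sqE sq0] : exists2 s, (s * s = al)%Re & (0 < s)%Re.
  by exists (sqrt al); [exact: sqrt_sqrt|exact: sqrt_lt_R0].
(* Scaled so that [b *m ctr b] agrees with [A] on row and column [i0]. *)
pose b := RtoC (/ sq) *: col i0 A.
have sqV : (/ sq * / sq = / al)%Re by rewrite -sqE; field; lra.
(* Nonnegativity of this Schur complement at [x] is Cauchy-Schwarz for [x] and [e]. *)
have pA' : psd (A - b *m ctr b).
  split=> [|x]; first by rewrite ctrD ctrN ctrM ctrK -pA.1.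
  rewrite -[X in cre X]/(hform _ _ _) hformD hformN hform_rank1 creD creN /=.
  rewrite -scalemxAr mxE Cabs2M -he Cabs2_RtoC sqV.
  have := psd_cauchy_schwarz x e pA; rewrite hee -/al => h.
  have h1 : (/ al * Cabs2 (hform A x e) <= / al * (cre (hform A x x) * al))%Re.
    by apply: Rmult_le_compat_l => //; apply/Rlt_le/Rinv_0_lt_compat.
  have h2 : (/ al * (cre (hform A x x) * al) = cre (hform A x x))%Re by field; lra.
  by change R0 with 0%Re; lra.
have [|B eB] := IH _ pA'.
  move=> i j ki; rewrite !mxE big_ord1 ctrE !mxE rmorphM /=.
  rewrite -[Defs_Cconj__canonical__GRing_RMorphism _]/(Cconj _) Cconj_RtoC.
  move: ki; rewrite leq_eqVlt => /orP [/eqP ki|ki]; last first.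
    by rewrite (hA i j) // (hA i i0) // mulr0 mul0r subrr.
  have -> : i = i0 by apply: val_inj.
  rewrite hal -hconj mulrCA !mulrA -!RtoCM.
  have -> : (/ sq * / sq * al = 1)%Re by rewrite sqV; field; lra.
  by rewrite mul1r subrr.
exists (row_mx b B : 'M_(n, 1 + k)); rewrite (@row_mx_gram n 1 k) -eB addrC subrK //.
Qed.

Lemma psd_gramE n k (A : 'M[Cplx]_n) : psd A -> (n <= k)%N ->
  exists B : 'M[Cplx]_(n, k), A = B *m ctr B.
Proof.
move=> pA nk; apply: psd_factor => // i j ki.
by have := leq_trans (ltn_ord i) (leq_trans nk ki); rewrite ltnn.
Qed.

(* [W] is the Householder reflection exchanging [v] and the first basis vector. *)
Lemma householder n (v : 'cV[Cplx]_n.+1) : cnorm2 v = R1 -> cim (v ord0 ord0) = R0 ->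
  exists2 W : 'M[Cplx]_n.+1, W *m ctr W = 1%:M & col ord0 W = v.
Proof.
move=> v1 vr; pose e : 'cV[Cplx]_n.+1 := delta_mx ord0 ord0; pose w := e - v.
have ce : ctr e = delta_mx ord0 ord0 by rewrite /ctr map_delta_mx trmx_delta.
have [w0|w0] := eqVneq w 0.
  exists 1%:M; first by rewrite ctr1 mulmx1.
  by move/eqP: w0; rewrite colE mul1mx subr_eq0 => /eqP.
have nw0 := cnorm2_gt0 w0.
have we : (ctr w *m e) ord0 ord0 = RtoC (1 - cre (v ord0 ord0)).
  rewrite -colE mxE ctrE /w /e !mxE !eqxx.
  by apply: C_ext; rewrite /= ?CplxE /= ?vr; change R0 with 0%Re; ring.
(* Since [v] and [e] are unit vectors and their inner product is real, the squared norm of [w] is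
   twice the inner product of [w] with [e]; the reflection therefore subtracts exactly [w] from
   [e]. *)
have nw : cnorm2 w = (2 * (1 - cre (v ord0 ord0)))%Re.
  apply: RtoC_inj; rewrite -hform1 {1}/w hformDl -(scaleN1r v) hformZl.
  rewrite /w !hformDr -(scaleN1r v) !hformZr !hform1 v1.
  have -> : cnorm2 e = R1.
    by apply: RtoC_inj; rewrite -hform1 /hform mulmx1 ce -rowE !mxE eqxx.
  have hev : hform 1%:M e v = v ord0 ord0 by rewrite /hform mulmx1 ce -rowE mxE.
  rewrite hev (hform_hermC e v (esym (ctr1 _))) hev.
  by apply: C_ext; rewrite ?CplxE /= ?CplxE /= ?vr; ring.
have vE : v = e - w by rewrite /w opprB addrC subrK.
clearbody w.
set be := RtoC (2 / cnorm2 w).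
have gw : ctr w *m w = (RtoC (cnorm2 w))%:M.
  by rewrite [LHS]mx11_scalar; congr _%:M; rewrite -hform1 /hform mulmx1.
have hW : 1%:M - be *: (w *m ctr w) = ctr (1%:M - be *: (w *m ctr w)).
  by rewrite ctrD ctr1 ctrN ctrZ ctrM ctrK Cconj_RtoC.
exists (1%:M - be *: (w *m ctr w)).
  rewrite -hW mulmxBr mulmx1 mulmxBl mul1mx -scalemxAl -!scalemxAr.
  rewrite mulmxA -(mulmxA w) gw mul_mx_scalar -scalemxAl !scalerA.
  have -> : be * (be * RtoC (cnorm2 w)) = be + be.
    by rewrite /be -!RtoCM -RtoCD; congr RtoC; field; lra.
  by rewrite scalerDl opprB addrK subrK.
rewrite colE mulmxBl mul1mx -scalemxAl -mulmxA -/e.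
rewrite [ctr w *m e]mx11_scalar we mul_mx_scalar scalerA.
have -> : be * RtoC (1 - cre (v ord0 ord0)) = 1.
  by rewrite /be nw -RtoCM -RtoC1; congr RtoC; field; rewrite nw in nw0; lra.
by rewrite scale1r vE.
Qed.

(** Householder reflection needs a unit vector with real first entry. The multiplier [c1] makes that
    entry real, and [/ s] normalizes. *)
Lemma unitary_first_col n (v : 'cV[Cplx]_n.+1) : v != 0 ->
  exists (W : 'M[Cplx]_n.+1) (c : Cplx),
    [/\ W *m ctr W = 1%:M, c != 0 & col ord0 W = c *: v].
Proof.
move=> v0; pose c1 := if v ord0 ord0 == 0 then 1 else Cconj (v ord0 ord0).
have c10 : c1 != 0.
  rewrite /c1; case: (eqVneq (v ord0 ord0) 0) => [_|h]; first exact: oner_neq0.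
  by apply: contraNneq h => h; rewrite -[v _ _]CconjK h rmorph0.
have v1 : c1 *: v != 0 by rewrite scaler_eq0 negb_or c10.
have r1 : cim ((c1 *: v) ord0 ord0) = R0.
  rewrite mxE /c1; case: (eqVneq (v ord0 ord0) 0) => [->|_]; first by rewrite mulr0.
  by rewrite mulCconj.
have n1 := cnorm2_gt0 v1.
have [s s0 hs] : exists2 s, (0 < s)%Re & (s * s = cnorm2 (c1 *: v))%Re.
  by exists (sqrt (cnorm2 (c1 *: v))); [apply: sqrt_lt_R0|apply: sqrt_sqrt; lra].
have sV0 : RtoC (/ s) != 0.
  by apply/eqP => /RtoC_inj; have := Rinv_0_lt_compat _ s0; change R0 with 0%Re; lra.
have [||W hW cW] := @householder n (RtoC (/ s) *: (c1 *: v)).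
- rewrite cnorm2Z Cabs2_RtoC -hs; change R1 with 1%Re; field; lra.
- by rewrite mxE cimM r1 /=; change R0 with 0%Re; ring.
by exists W, (RtoC (/ s) * c1); split=> //; rewrite ?mulf_neq0 // -scalerA.
Qed.

(* If [v^* G v - d |v|^2] had a constant strict sign, [G - d] or [d - G] would be
   positive definite, and [det G] would differ from [d ^ n]. *)
Lemma posdef_attains_mean n (G : 'M[Cplx]_n.+1) (d : R) : posdef G -> (0 < d)%Re ->
  \det G = RtoC (d ^ n.+1) ->
  exists2 v : 'cV[Cplx]_n.+1, v != 0 & (cre (hform G v v) = d * cnorm2 v)%Re.
Proof.
move=> pG d0 dG; pose D := (RtoC d)%:M : 'M[Cplx]_n.+1.
have hD : D = ctr D by rewrite ctr_scalar Cconj_RtoC.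
have pD : posdef D.
  split=> // x x0; rewrite hform_scalar /=.
  by apply: Rmult_lt_0_compat => //; apply: cnorm2_gt0.
have dD : \det D = RtoC (d ^ n.+1) by rewrite det_scalar RtoCX.
have dn : (0 < d ^ n.+1)%Re by apply: pow_lt.
pose Q := G - D; have hQ : Q = ctr Q by rewrite ctrD ctrN -pG.1 -hD.
pose q v := cre (hform Q v v).
(* Adding a positive definite matrix strictly increases the determinant. *)
have strict (A E : 'M[Cplx]_n.+1) : posdef A -> posdef E ->
    \det A = RtoC (d ^ n.+1) -> \det (A + E) = RtoC (d ^ n.+1) -> False.
  move=> pA pE dA dAE; have [B eB] := psd_gramE (posdef_psd pE) (leqnn n.+1).
  have E0 : E != 0.
    apply/eqP => E0; have := posdef_unit pE.
    by rewrite E0 unitmxE det0 unitr0.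
  rewrite eB in E0 dAE; have [r r1 e] := det_ratio_gt1 pA E0.
  by move: e; rewrite dAE dA -RtoCM => /RtoC_inj; nra.
have qE v : q v = (cre (hform G v v) - d * cnorm2 v)%Re.
  by rewrite /q hformD hformN hform_scalar creD creN.
have [u u0 qu] : exists2 u, u != 0 & (0 <= q u)%Re.
  apply: NNPP => hn; apply: (@strict G (- Q)) => //; last by rewrite opprB addrC subrK.
  split=> [|x x0]; first by rewrite ctrN -hQ.
  rewrite hformN creN -/(q x); apply: Rnot_le_lt => h; apply: hn; exists x => //.
  by change R0 with 0%Re in h; lra.
have [w w0 qw] : exists2 w, w != 0 & (q w <= 0)%Re.
  apply: NNPP => hn; apply: (@strict D Q) => //; last by rewrite addrC subrK.
  split=> [//|x x0]; apply: Rnot_le_lt => h; apply: hn; exists x => //.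
suff [v v0 qv] : exists2 v, v != 0 & q v = R0.
  by exists v => //; move: qv; rewrite qE; change R0 with 0%Re; lra.
case: (Rle_lt_or_eq_dec _ _ qu) => [qu0|]; last by exists u.
case: (Rle_lt_or_eq_dec _ _ qw) => [qw0|]; last by exists w.
pose b := cre (hform Q u w).
have qs s : q (u + RtoC s *: w) = (q u + 2 * s * b + s * s * q w)%Re.
  rewrite /q !hformDl !hformDr !hformZl !hformZr Cconj_RtoC (hform_hermC u w hQ).
  by rewrite !creD !cre_scale /b /=; ring.
have disc0 : (0 <= b * b - q u * q w)%Re by nra.
(* A root of the quadratic [q (u + RtoC s *: w)] in [s]; it is real because [q u] and [q w] have
   opposite signs. *)
pose s := ((- b - sqrt (b * b - q u * q w)) / q w)%Re.
exists (u + RtoC s *: w).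
  (* If the combination vanished, [u] would be a multiple of [w], and [q u] could not be
     positive. *)
  apply/eqP => /eqP; rewrite addr_eq0 => /eqP e; move: qu0.
  rewrite e /q -scaleN1r scalerA hformZl hformZr mulrA mulCconj cre_scale.
  by rewrite -/(q w); have := Cabs2_ge0 (-1 * RtoC s); nra.
rewrite qs /s; have := sqrt_sqrt _ disc0; set t := sqrt _ => ht.
change R0 with 0%Re.
have -> : (q u + 2 * ((- b - t) / q w) * b + (- b - t) / q w * ((- b - t) / q w) * q w
           = (q u * q w - b * b + t * t) / q w)%Re by field; lra.
by rewrite ht; field; lra.
Qed.

(** The matrix [G] has determinant [d ^ M], so its form equals [d] on some unit vector. Rotating
    that vector into the first column gives this stream the value [d - 1]. Absorbing the stream into
    [K] uses up one factor [d], so the induction applies to the other columns. *)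
Lemma unitary_equal_mmse n M (B : 'M[Cplx]_(n, M)) (K : 'M[Cplx]_n) (d : R) :
  posdef K -> (0 < d)%Re -> \det (K + B *m ctr B) = RtoC (d ^ M) * \det K ->
  exists2 V : 'M[Cplx]_M, V *m ctr V = 1%:M &
    forall m, mmse (K + prefix_gram (B *m V) m) (col m (B *m V)) = (d - 1)%Re.
Proof.
move=> + d0; elim: M B K => [B K _ _|M IH B K pK detB].
  by exists 1%:M => [|[]//]; rewrite ctr1 mulmx1.
have detK : \det K != 0 by rewrite -unitfE -unitmxE posdef_unit.
pose G := 1%:M + ctr B *m invmx K *m B.
have pG : posdef G.
  apply: posdefD; first exact: posdef1.
  by have := psd_congr (ctr B) (posdef_psd (posdef_invmx pK)); rewrite ctrK.
have detG : \det G = RtoC (d ^ M.+1).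
  by move: detB; rewrite det_update // => /(mulIf detK).
have [v v0 hv] := posdef_attains_mean pG d0 detG.
have [W [c [WW c0 W0]]] := unitary_first_col v0.
have hb : mmse K (B *m col ord0 W) = (d - 1)%Re.
  have u1 : cnorm2 (col ord0 W) = 1%Re.
    apply: RtoC_inj; rewrite -hform1 colE -hform_congr mulmx1 (mulmx1C WW) hform1.
    by congr RtoC; apply: RtoC_inj; rewrite -hform1 /hform mulmx1 -colE !mxE eqxx rmorph1.
  have : cre (hform G (col ord0 W) (col ord0 W)) = d.
    rewrite -[RHS]Rmult_1_r -u1 W0 cnorm2Z hformZl hformZr mulrA mulCconj.
    by rewrite cre_scale hv; ring.
  rewrite hformD creD hform1 u1 hform_congr /mmse /= => e.
  by apply: (Rplus_eq_reg_l 1); rewrite e; ring.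
pose B1 : 'M_(n, 1 + M) := B *m W; pose b := lsubmx B1; pose B' := rsubmx B1.
have eb : b = B *m col ord0 W by rewrite /b -col_first !colE mulmxA.
have eB1 : row_mx b B' = B1 by apply: hsubmxK.
have gB : B *m ctr B = b *m ctr b + B' *m ctr B'.
  by rewrite -gram_split ctrM mulmxA -(mulmxA B) WW mulmx1.
have detb : \det (K + b *m ctr b) = RtoC d * \det K.
  by rewrite det_rank1_update // eb hb; congr (RtoC _ * _); ring.
have [||V VV hV] := IH B' (K + b *m ctr b).
- by apply: posdefD => //; apply: psd_gram.
- by rewrite -addrA -gB detB detb /= mulrA -RtoCM; congr (RtoC _ * _); ring.
(* The later rotation must fix the first column, which is already settled. *)
pose U : 'M_(1 + M) := block_mx 1%:M 0 0 V.
have UU : U *m ctr U = 1%:M.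
  rewrite /U /ctr map_block_mx tr_block_mx -!/(ctr _) !ctr0 ctr1 mulmx_block.
  by rewrite !(mulmx0, mul0mx, addr0, add0r, mulmx1) VV -scalar_mx_block.
have BV : B *m (W *m U) = row_mx b (B' *m V) :> 'M_(n, 1 + M).
  rewrite mulmxA; transitivity (B1 *m U) => //; rewrite -eB1 /U.
  by rewrite (@mul_row_block _ n 1 M 1 M) !(mulmx0, addr0, add0r) mulmx1.
exists (W *m U) => [|m].
  by rewrite ctrM mulmxA -(mulmxA W) UU mulmx1.
rewrite BV; case: (unliftP ord0 m) => [j ->|->].
  rewrite (@prefix_gram_lift n M) (@col_lift n M) row_mxKl row_mxKr addrA.
  exact: hV.
by rewrite (@prefix_gram0 n M) (@col_first n M) row_mxKl addr0 eb.
Qed.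

(* While there are more columns than [\rank H], a unitary rotation makes [H] kill
   one of them, which can then be dropped. *)
Lemma gram_drop_columns q n k r (H : 'M[Cplx]_(q, n)) (B : 'M[Cplx]_(n, k + r)) :
  (\rank H <= r)%N ->
  exists2 C : 'M[Cplx]_(n, r),
    H *m (C *m ctr C) *m ctr H = H *m (B *m ctr B) *m ctr H &
    psd (B *m ctr B - C *m ctr C).
Proof.
move=> rH; elim: k B => [B|k IH B]; first by exists B; rewrite ?subrr //; apply: psd0.
have [x x0 hx] : exists2 x : 'cV[Cplx]_(k + r).+1, x != 0 & H *m B *m x = 0.
  (* [H *m B] has more columns than its rank; [kermx] acts on rows, hence the transpose. *)
  have : kermx (H *m B)^T != 0.
    rewrite kermx_eq0 /row_free mxrank_tr neq_ltn (leq_ltn_trans (mxrankM_maxl _ _)) //.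
    by rewrite (leq_ltn_trans rH) // ltnS leq_addl.
  case/rowV0Pn => v /sub_kermxP hv v0; exists v^T.
    by rewrite -[0]trmx0 (inj_eq trmx_inj).
  by rewrite -[H *m B]trmxK -trmx_mul hv trmx0.
have [W [c [WW c0 W0]]] := unitary_first_col x0.
pose B1 : 'M_(n, 1 + (k + r)) := B *m W; pose b := lsubmx B1; pose B' := rsubmx B1.
have Hb : H *m b = 0.
  rewrite /b -col_first colE mulmxA /B1 -mulmxA -mulmxA -colE W0 -scalemxAr.
  by rewrite -scalemxAr mulmxA hx scaler0.
have gB : B *m ctr B = b *m ctr b + B' *m ctr B'.
  by rewrite -gram_split ctrM mulmxA -(mulmxA B) WW mulmx1.
have [C eC pC] := IH B'; exists C.
  by rewrite gB mulmxDr (mulmxA H b) Hb mul0mx add0r.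
by rewrite gB -addrA; apply: psdD => //; apply: psd_gram.
Qed.

Lemma psd_rank_reduction q n (H : 'M[Cplx]_(q, n)) (S : 'M[Cplx]_n) : psd S ->
  exists2 C : 'M[Cplx]_(n, \rank H),
    H *m (C *m ctr C) *m ctr H = H *m S *m ctr H & psd (S - C *m ctr C).
Proof.
move=> pS; have en : (n = (n - \rank H) + \rank H)%N by rewrite subnK ?rank_leq_col.
have [|B ->] := @psd_gramE n (n - \rank H + \rank H) _ pS; first by rewrite -en.
exact: gram_drop_columns.
Qed.

(** Splits a column into a power and a unit direction. For [y = 0] the direction is an arbitrary
    basis vector, which requires a nonzero dimension. *)
Lemma normalize n (y : 'cV[Cplx]_n) : (0 < n)%N ->
  exists2 t : 'cV[Cplx]_n, cnorm2 t = 1%Re & RtoC (sqrt (cnorm2 y)) *: t = y.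
Proof.
move=> n0; have [->|y0] := eqVneq y 0.
  exists (delta_mx (Ordinal n0) ord0).
    apply: RtoC_inj; rewrite -hform1 /hform mulmx1 /ctr map_delta_mx trmx_delta.
    by rewrite -rowE !mxE !eqxx.
  have -> : cnorm2 (0 : 'cV[Cplx]_n) = 0%Re.
    by apply: RtoC_inj; rewrite -hform1 /hform mulmx0 mxE.
  by rewrite sqrt_0 scale0r.
have s0 := sqrt_lt_R0 _ (cnorm2_gt0 y0).
exists (RtoC (/ sqrt (cnorm2 y)) *: y).
  rewrite cnorm2Z Cabs2_RtoC -{3}(sqrt_sqrt _ (cnorm2_ge0 y)); field; lra.
by rewrite scalerA -RtoCM Rinv_r ?scale1r //; lra.
Qed.

(** Equality in [mmse_optimal] occurs when [r] is proportional to [invmx K *m b], and the quotient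
    is unchanged by normalizing [r]. *)
Lemma mmse_receiver n (K : 'M[Cplx]_n) (b : 'cV[Cplx]_n) : (0 < n)%N -> posdef K ->
  exists2 r : 'cV[Cplx]_n, cnorm2 r = 1%Re &
    (Cabs2 ((ctr r *m b) ord0 ord0) / cre (hform K r r) = mmse K b)%Re.
Proof.
move=> n0 pK; have [b0|b0] := eqVneq b 0.
  have [r r1 _] := normalize 0 n0; exists r => //.
  rewrite b0 mulmx0 /mmse /hform mulmx0 mxE /Cabs2 /=.
  by change (cre 0) with 0%Re; change (cim 0) with 0%Re; rewrite /Rdiv; ring.
have [r r1 er] := normalize (invmx K *m b) n0; exists r => //.
have pm : (0 < mmse K b)%Re := (posdef_invmx pK).2 _ b0.
have r0 : r != 0.
  apply: contraNneq b0 => r0; have uK := posdef_unit pK.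
  by rewrite -[b](mulKVmx uK) -er r0 scaler0 mulmx0.
have pr := pK.2 _ r0; move: er; set s := sqrt _ => er.
have e1 : mmse K b = (s * s * cre (hform K r r))%Re.
  rewrite /mmse hform_invmx // -er hformZl hformZr mulrA mulCconj cre_scale.
  by rewrite Cabs2_RtoC.
have e2 : (ctr r *m b) ord0 ord0 = RtoC s * hform K r r.
  by rewrite -hformZr er /hform -mulmxA mulKVmx // posdef_unit.
rewrite e2 Cabs2M Cabs2_RtoC (hform_herm_real r pK.1) Cabs2_RtoC e1 /=; field; lra.
Qed.

(** * Stream strategies *)

(** Dimensions vary with the link, so choosing one object per link calls for a dependent
    function. *)
Lemma dep_choice (I : Type) (A : I -> Type) (P : forall i, A i -> Prop) :
  (forall i, exists y, P i y) -> exists f : forall i, A i, forall i, P i (f i).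
Proof.
move=> h; exists (fun i => proj1_sig (constructive_indefinite_description _ (h i))).
by move=> i; apply: proj2_sig.
Qed.

Lemma RtoC_Rsum n (f : 'I_n -> R) : RtoC (Rsum f) = \sum_(i < n) RtoC (f i).
Proof. exact: (big_morph RtoC RtoCD RtoC0). Qed.

Lemma hform_sum n (I : Type) (r : seq I) (P : pred I) (F : I -> 'M[Cplx]_n) x y :
  hform (\sum_(i <- r | P i) F i) x y = \sum_(i <- r | P i) hform (F i) x y.
Proof.
apply: (big_morph (fun A => hform A x y)) => [A B|]; first exact: hformD.
by rewrite /hform mulmx0 mul0mx mxE.
Qed.

Lemma hform_scale n c (A : 'M[Cplx]_n) x y : hform (c *: A) x y = c * hform A x y.
Proof. by rewrite /hform -scalemxAr -scalemxAl mxE. Qed.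

Lemma gram_sum n M (B : 'M[Cplx]_(n, M)) :
  B *m ctr B = \sum_j col j B *m ctr (col j B).
Proof.
apply/matrixP => i k; rewrite mxE summxE; apply: eq_bigr => j _.
by rewrite !mxE big_ord1 !mxE.
Qed.

Lemma scaled_gram n (y : 'cV[Cplx]_n) a : (0 <= a)%Re ->
  (RtoC (sqrt a) *: y) *m ctr (RtoC (sqrt a) *: y) = RtoC a *: (y *m ctr y).
Proof.
move=> a0; rewrite ctrZ Cconj_RtoC -scalemxAl -scalemxAr scalerA -RtoCM.
by rewrite sqrt_sqrt.
Qed.

Lemma rank1_trace n (y : 'cV[Cplx]_n) : \tr (y *m ctr y) = RtoC (cnorm2 y).
Proof. by rewrite mxtrace_mulC -hform1 /hform mulmx1 /mxtrace big_ord1. Qed.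

Lemma gram_trace n M (B : 'M[Cplx]_(n, M)) :
  \tr (B *m ctr B) = RtoC (Rsum (fun j => cnorm2 (col j B))).
Proof.
rewrite gram_sum raddf_sum RtoC_Rsum; apply: eq_bigr => j _ /=.
by rewrite rank1_trace.
Qed.

Lemma psd_trace_ge0 n (A : 'M[Cplx]_n) : psd A -> (0 <= cre (\tr A))%Re.
Proof.
move=> /psd_gramE /(_ (leqnn n)) [B ->]; rewrite gram_trace /=.
by apply: Rsum_ge0 => j; apply: cnorm2_ge0.
Qed.

(** Identifies the modulus inside [rate] with a ratio of determinants of received covariances. *)
Lemma Cmod_det_ratio n (Om X : 'M[Cplx]_n) (rho : R) : posdef Om -> (0 <= rho)%Re ->
  \det (Om + X) = RtoC rho * \det Om -> Cmod (\det (1%:M + X *m invmx Om)) = rho.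
Proof.
move=> /posdef_unit uO r0 e.
have -> : 1%:M + X *m invmx Om = (Om + X) *m invmx Om by rewrite mulmxDl mulmxV.
rewrite det_mulmx e det_inv mulrK; last by rewrite -unitmxE.
by rewrite /Cmod Cabs2_RtoC sqrt_square.
Qed.

Lemma sum_rev (V : zmodType) M (F : 'I_M -> V) (P : pred 'I_M) :
  \sum_(j < M | P j) F j = \sum_(j < M | P (rev_ord j)) F (rev_ord j).
Proof. exact: (reindex_inj rev_ord_inj). Qed.

Section Streams.
Variables (L : nat) (LT LR : 'I_L -> nat)
  (H : forall l k : 'I_L, 'M[Cplx]_(LR l, LT k)) (Phi : 'I_L -> 'I_L -> bool).
Hypothesis Phi_diag : forall l, Phi l l = false.
Implicit Types (T : TxVecs H) (Rv : RxVecs H) (p : Powers H).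

Lemma posdef_Omega (Sigma : forall k : 'I_L, 'M[Cplx]_(LT k)) l :
  (forall k, psd (Sigma k)) -> posdef (Omega H Phi Sigma l).
Proof.
move=> pS; apply: posdefD; first exact: posdef1.
by apply: psd_sum => k; apply: psd_congr.
Qed.

Definition cov T p (k : 'I_L) : 'M[Cplx]_(LT k) :=
  \sum_(n < nstreams H k) RtoC (p k n) *: (T k n *m ctr (T k n)).

(** The covariance whose quadratic form at the receive vector is the SINR denominator. *)
Definition noise T p l (m : 'I_(nstreams H l)) : 'M[Cplx]_(LR l) :=
  Omega H Phi (cov T p) l +
  \sum_(n < nstreams H l | (m < n)%N)
     RtoC (p l n) *: ((H l l *m T l n) *m ctr (H l l *m T l n)).

(* Columns are listed in reverse decoding order, so that the streams which still
   interfere with a given one precede it, as in [prefix_gram]. *)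
Definition signal T p l : 'M[Cplx]_(LR l, nstreams H l) :=
  \matrix_(i, j) (RtoC (sqrt (p l (rev_ord j))) *: (H l l *m T l (rev_ord j))) i ord0.

Lemma col_signal T p l j :
  col j (signal T p l) = RtoC (sqrt (p l (rev_ord j))) *: (H l l *m T l (rev_ord j)).
Proof. by apply/colP => i; rewrite !mxE. Qed.

Lemma psd_cov T p k : (forall n, 0 <= p k n)%Re -> psd (cov T p k).
Proof.
by move=> p0; apply: psd_sum => n; rewrite -scaled_gram //; apply: psd_gram.
Qed.

(** Index reversal turns the streams decoded after [m] into the columns before [rev_ord m]. *)
Lemma noiseE T p l m : (forall n, 0 <= p l n)%Re ->
  noise T p m = Omega H Phi (cov T p) l + prefix_gram (signal T p l) (rev_ord m).
Proof.
move=> p0; congr (_ + _); rewrite /prefix_gram [RHS]sum_rev.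
apply: eq_big => [n|n _]; first by rewrite /= ltn_sub2lE.
by rewrite col_signal rev_ordK scaled_gram.
Qed.

Lemma posdef_noise T p l (m : 'I_(nstreams H l)) :
  (forall k n, 0 <= p k n)%Re -> posdef (noise T p m).
Proof.
move=> p0; rewrite noiseE //; apply: posdefD; last exact: psd_prefix_gram.
by apply: posdef_Omega => k; apply: psd_cov.
Qed.

Lemma signal_gram T p l : (forall n, 0 <= p l n)%Re ->
  H l l *m cov T p l *m ctr (H l l) = signal T p l *m ctr (signal T p l).
Proof.
move=> p0; rewrite gram_sum [RHS]sum_rev mulmx_sumr mulmx_suml.
apply: eq_bigr => n _; rewrite col_signal rev_ordK scaled_gram //.
by rewrite -scalemxAr -scalemxAl ctrM !mulmxA.
Qed.

Lemma hform_link_cov T p l k (r : 'cV[Cplx]_(LR l)) :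
  hform (H l k *m cov T p k *m ctr (H l k)) r r
  = \sum_n RtoC (p k n * gain r (H l k) (T k n)).
Proof.
rewrite mulmx_sumr mulmx_suml hform_sum; apply: eq_bigr => n _.
rewrite -scalemxAr -scalemxAl hform_scale RtoCM; congr (_ * _).
have -> : H l k *m (T k n *m ctr (T k n)) *m ctr (H l k)
          = (H l k *m T k n) *m ctr (H l k *m T k n) by rewrite ctrM !mulmxA.
by rewrite hform_rank1 mulmxA.
Qed.

Lemma interferenceE T Rv p l (m : 'I_(nstreams H l)) : cnorm2 (Rv l m) = 1%Re ->
  RtoC (1 + Rsum (fun k => Rsum (fun n => p k n * Psi Phi T Rv m n)))%Re
  = hform (noise T p m) (Rv l m) (Rv l m).
Proof.
move=> r1; rewrite /noise /Omega !hformD hform1 r1 RtoCD -addrA; congr (_ + _).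
pose S k := \sum_(n < nstreams H k | (m < n)%N)
  RtoC (p k n * gain (Rv l m) (H l k) (T k n)).
transitivity (\sum_(k < L | Phi l k)
    hform (H l k *m cov T p k *m ctr (H l k)) (Rv l m) (Rv l m) + S l); last first.
  rewrite !hform_sum; congr (_ + _); apply: eq_bigr => n _.
  by rewrite hform_scale RtoCM hform_rank1 mulmxA.
(* Spread over all links, the own-link term merges with the cross-link sum; [Phi_diag] keeps the two
   from overlapping at [k = l]. *)
have -> : S l = \sum_(k < L) (if k == l then S k else 0).
  by rewrite -big_mkcond /= big_pred1_eq.
rewrite [X in X + _]big_mkcond -big_split RtoC_Rsum.
apply: eq_bigr => k _; rewrite RtoC_Rsum /Psi /=.
case: (eqVneq k l) => [e|_].
  have -> : Phi l k = false by rewrite e Phi_diag.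
  rewrite add0r /S [RHS]big_mkcond; apply: eq_bigr => n _.
  by case: ifP => // _; rewrite Rmult_0_r.
rewrite addr0; case: ifP => _; first by rewrite hform_link_cov.
by rewrite big1 // => n _; rewrite Rmult_0_r.
Qed.

Lemma sinrE T Rv p l (m : 'I_(nstreams H l)) :
  (0 <= p l m)%Re -> cnorm2 (Rv l m) = 1%Re ->
  sinr Phi T Rv p m =
  (Cabs2 ((ctr (Rv l m) *m col (rev_ord m) (signal T p l)) ord0 ord0)
   / cre (hform (noise T p m) (Rv l m) (Rv l m)))%Re.
Proof.
move=> p0 r1; rewrite /sinr -interferenceE // col_signal rev_ordK.
congr (Rdiv _ _); rewrite -scalemxAr mxE Cabs2M Cabs2_RtoC sqrt_sqrt //.
by rewrite mulmxA.
Qed.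

(** Each SINR is at most the MMSE value of its stream, so the determinant ratio behind the rate is
    at least [c] to the number of streams. *)
Lemma rate_ge_sinr T Rv p l (c : R) :
  (forall k n, 0 <= p k n)%Re -> (forall m, cnorm2 (Rv l m) = 1%Re) -> (0 < c)%Re ->
  (forall m : 'I_(nstreams H l), (c <= 1 + sinr Phi T Rv p m)%Re) ->
  (INR (nstreams H l) * ln c <= rate H Phi (cov T p) l)%Re.
Proof.
move=> p0 r1 c0 hc.
have pO : posdef (Omega H Phi (cov T p) l) by apply: posdef_Omega => k; apply: psd_cov.
have [|m|rho hr e] := @det_ratio_chain _ _ (signal T p l) _ c pO; first exact: Rlt_le.
  rewrite -{1}(rev_ordK m) -noiseE //; apply: (Rle_trans _ _ _ (hc (rev_ord m))).
  apply: Rplus_le_compat_l; rewrite sinrE // rev_ordK.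
  have pn := posdef_noise T (rev_ord m) p0.
  have r0 : Rv l (rev_ord m) != 0.
    apply/eqP => r0; have := r1 (rev_ord m); rewrite r0.
    by rewrite /cnorm2 mulmx0 mxE /=; change (cre 0) with 0%Re; lra.
  have := mmse_optimal (col m (signal T p l)) (Rv l (rev_ord m)) pn.
  have := pn.2 _ r0; set x := cre _; set y := Cabs2 _; set z := mmse _ _ => x0 h.
  apply: (Rmult_le_reg_l x) => //.
  by rewrite (_ : (x * (y / x) = y)%Re) //; field; lra.
have hc' := pow_lt _ (nstreams H l) c0.
rewrite -signal_gram // in e.
rewrite /rate (Cmod_det_ratio pO _ e); last by lra.
rewrite -ln_pow //; case: hr => [hr|<-]; last by right.
by left; apply: ln_increasing.
Qed.

End Streams.

(** * From covariances to streams of equal SINR *)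

Lemma trace_cov (L : nat) (LT LR : 'I_L -> nat)
    (H : forall l k : 'I_L, 'M[Cplx]_(LR l, LT k)) (T : TxVecs H) (p : Powers H) k :
  (forall n, cnorm2 (T k n) = 1%Re) -> \tr (cov T p k) = RtoC (Rsum (p k)).
Proof.
move=> t1; rewrite raddf_sum RtoC_Rsum; apply: eq_bigr => n _ /=.
by rewrite mxtraceZ rank1_trace t1 RtoC1 mulr1.
Qed.

(** Rank reduction fixes the number of streams, rotation equalizes their MMSE values, and MMSE
    receivers attain these values as SINRs. *)
Lemma equal_sinr_strategy (L : nat) (LT LR : 'I_L -> nat)
    (H : forall l k : 'I_L, 'M[Cplx]_(LR l, LT k)) (Phi : 'I_L -> 'I_L -> bool)
    (Sigma : forall k : 'I_L, 'M[Cplx]_(LT k)) :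
  (forall l, Phi l l = false) -> (forall l, (0 < nstreams H l)%N) ->
  (forall l, psd (Sigma l)) ->
  exists (T : TxVecs H) (Rv : RxVecs H) (p : Powers H),
    [/\ forall (l : 'I_L) (m : 'I_(nstreams H l)),
          cnorm2 (T l m) = R1 /\ cnorm2 (Rv l m) = R1 /\ Rle R0 (p l m),
        forall l, (Rsum (p l) <= cre (\tr (Sigma l)))%Re &
        forall (l : 'I_L) (m : 'I_(nstreams H l)),
          (exp (rate H Phi Sigma l / INR (nstreams H l)) - 1 <= sinr Phi T Rv p m)%Re].
Proof.
move=> Phi_diag M0 pS.
have [C hC] : exists C : forall l, 'M[Cplx]_(LT l, nstreams H l), forall l,
    H l l *m (C l *m ctr (C l)) *m ctr (H l l) = H l l *m Sigma l *m ctr (H l l) /\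
    psd (Sigma l - C l *m ctr (C l)).
  apply: (dep_choice (P := fun l (C : 'M[Cplx]_(LT l, nstreams H l)) =>
    H l l *m (C *m ctr C) *m ctr (H l l) = H l l *m Sigma l *m ctr (H l l) /\
    psd (Sigma l - C *m ctr C))) => l.
  by have [C] := psd_rank_reduction (H l l) (pS l); exists C.
pose cov' k := C k *m ctr (C k).
have pc k : psd (cov' k) by apply: psd_gram.
have [V hV] : exists V : forall l, 'M[Cplx]_(nstreams H l), forall l,
    V l *m ctr (V l) = 1%:M /\
    forall m, (exp (rate H Phi Sigma l / INR (nstreams H l)) - 1 <=
      mmse (Omega H Phi cov' l + prefix_gram (H l l *m C l *m V l) m)
           (col m (H l l *m C l *m V l)))%Re.
  apply: (dep_choice (P := fun l (V : 'M[Cplx]_(nstreams H l)) =>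
    V *m ctr V = 1%:M /\
    forall m, (exp (rate H Phi Sigma l / INR (nstreams H l)) - 1 <=
      mmse (Omega H Phi cov' l + prefix_gram (H l l *m C l *m V) m)
           (col m (H l l *m C l *m V)))%Re)) => l.
  have pO := posdef_Omega H Phi l pS; have pO' := posdef_Omega H Phi l pc.
  have gB : H l l *m C l *m ctr (H l l *m C l) = H l l *m Sigma l *m ctr (H l l).
    by rewrite -(hC l).1 ctrM !mulmxA.
  (* The useful signal is unchanged while the interference shrinks, so the ratio can only grow from
     [r] to [r']. *)
  have [|r [r' [[r1 rr'] e e']]] := det_ratio_anti (H l l *m C l) pO pO'.
    rewrite /Omega opprD addrACA subrr add0r -sumrB; apply: psd_sum => k.
    by rewrite -mulmxBl -mulmxBr; apply: psd_congr; apply: (hC k).2.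
  have eR : rate H Phi Sigma l = ln r.
    by rewrite /rate (@Cmod_det_ratio _ _ _ r) // -?gB //; lra.
  set M := nstreams H l in C hC cov' pc pO' gB e e' eR *.
  have Mr : (0 < INR M)%Re by apply/lt_0_INR/ltP/M0.
  (* The geometric mean of the [M] factors whose product is [r']. *)
  pose d := exp (ln r' / INR M).
  have dM : (d ^ M = r')%Re.
    rewrite -Rpower_pow; last exact: exp_pos.
    rewrite /Rpower /d ln_exp (_ : (INR M * (ln r' / INR M) = ln r')%Re) ?exp_ln //.
      by lra.
    by field; lra.
  have [||W WW hW] := @unitary_equal_mmse _ _ (H l l *m C l) _ d pO'.
  - exact: exp_pos.
  - by rewrite dM.
  exists W; split=> // m; rewrite hW; apply: Rplus_le_compat_r.
  have h : (ln r / INR M <= ln r' / INR M)%Re.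
    apply: Rmult_le_compat_r; first by apply/Rlt_le/Rinv_0_lt_compat.
    by case: rr' => [h|->]; [left; apply: ln_increasing; lra|right].
  by rewrite eR /d; case: h => [h|->]; [left; apply: exp_increasing|right].
pose Y l := C l *m V l.
have gY l : Y l *m ctr (Y l) = cov' l.
  by rewrite /Y ctrM mulmxA -(mulmxA (C l)) (hV l).1 mulmx1.
(* The reversal compensates for the one in [signal], so that [signal] becomes
   [H l l *m C l *m V l]. *)
pose y l (n : 'I_(nstreams H l)) := col (rev_ord n) (Y l).
pose p : Powers H := fun l n => cnorm2 (y l n).
have p0 l n : (0 <= p l n)%Re by apply: cnorm2_ge0.
have [T hT] : exists T : TxVecs H, forall l (n : 'I_(nstreams H l)),
    cnorm2 (T l n) = 1%Re /\ RtoC (sqrt (p l n)) *: T l n = y l n.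
  apply: (dep_choice (P := fun l (t : 'I_(nstreams H l) -> 'cV[Cplx]_(LT l)) =>
    forall n, cnorm2 (t n) = 1%Re /\ RtoC (sqrt (p l n)) *: t n = y l n)) => l.
  apply: (dep_choice (P := fun n t =>
    cnorm2 t = 1%Re /\ RtoC (sqrt (p l n)) *: t = y l n)) => n.
  have [|t t1 te] := normalize (y l n); last by exists t.
  exact: leq_trans (M0 l) (rank_leq_col _).
have [Rv hR] : exists Rv : RxVecs H, forall l (m : 'I_(nstreams H l)),
    cnorm2 (Rv l m) = 1%Re /\
    (Cabs2 ((ctr (Rv l m) *m col (rev_ord m) (signal T p l)) ord0 ord0)
      / cre (hform (noise Phi T p m) (Rv l m) (Rv l m)) =
    mmse (noise Phi T p m) (col (rev_ord m) (signal T p l)))%Re.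
  apply: (dep_choice (P := fun l (r : 'I_(nstreams H l) -> 'cV[Cplx]_(LR l)) =>
    forall m, cnorm2 (r m) = 1%Re /\
    (Cabs2 ((ctr (r m) *m col (rev_ord m) (signal T p l)) ord0 ord0)
      / cre (hform (noise Phi T p m) (r m) (r m)) =
    mmse (noise Phi T p m) (col (rev_ord m) (signal T p l)))%Re)) => l.
  apply: (dep_choice (P := fun m r => cnorm2 r = 1%Re /\
    (Cabs2 ((ctr r *m col (rev_ord m) (signal T p l)) ord0 ord0)
      / cre (hform (noise Phi T p m) r r) =
    mmse (noise Phi T p m) (col (rev_ord m) (signal T p l)))%Re)) => m.
  have [||r r1 er] := @mmse_receiver _ (noise Phi T p m)
    (col (rev_ord m) (signal T p l)); last by exists r.
    exact: leq_trans (M0 l) (rank_leq_row _).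
  exact: posdef_noise.
have ecov k : cov T p k = cov' k.
  rewrite -gY gram_sum [RHS]sum_rev; apply: eq_bigr => n _.
  by rewrite -scaled_gram // (hT k n).2.
have eO l : Omega H Phi (cov T p) l = Omega H Phi cov' l.
  by congr (_ + _); apply: eq_bigr => k _; rewrite ecov.
have esig l : signal T p l = H l l *m C l *m V l.
  have -> : H l l *m C l *m V l = H l l *m Y l by rewrite mulmxA.
  apply/matrixP => i j; rewrite mxE scalemxAr (hT l _).2 /y rev_ordK.
  by rewrite colE mulmxA -colE mxE.
exists T, Rv, p; split=> [l m|l|l m].
- by split; [exact: (hT l m).1|split; [exact: (hR l m).1|exact: p0]].
- have := psd_trace_ge0 (hC l).2; rewrite (mxtraceD (Sigma l)) creD.
  rewrite -scaleN1r mxtraceZ mulN1r creN.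
  rewrite -[C l *m _]/(cov' l) -ecov trace_cov /=; first by lra.
  by move=> n; apply: (hT l n).1.
rewrite sinrE //; last exact: (hR l m).1.
by rewrite (hR l m).2 noiseE // eO esig; apply: (hV l).2.
Qed.

(** * Relative errors in rates and in SINRs *)

Lemma exp_convex (a e : R) : (0 <= e <= 1)%Re ->
  (exp ((1 - e) * a) <= 1 + (1 - e) * (exp a - 1))%Re.
Proof.
move=> e01; set x := ((1 - e) * a)%Re.
have h1 := exp_ineq1_le (a - x); have h2 := exp_ineq1_le (- x); have x0 := exp_pos x.
have e1 : exp a = (exp x * exp (a - x))%Re by rewrite -exp_plus; congr exp; ring.
have e2 : (exp x * exp (- x) = 1)%Re.
  by rewrite -exp_plus (_ : (x + - x = 0)%Re) ?exp_0 //; ring.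
(* [h3] and [h4] bound the tangent at [x] by the exponential at [a] and at [0]; weighting them by
   [1 - e] and [e] recovers [exp x]. *)
have h3 : (exp x * (1 + (a - x)) <= exp a)%Re.
  by rewrite e1; apply: Rmult_le_compat_l; lra.
have h4 : (exp x * (1 + - x) <= 1)%Re.
  by rewrite -[X in (_ <= X)%Re]e2; apply: Rmult_le_compat_l; lra.
have h5 : ((1 - e) * (exp x * (1 + (a - x))) <= (1 - e) * exp a)%Re.
  by apply: Rmult_le_compat_l; lra.
have h6 : (e * (exp x * (1 + - x)) <= e * 1)%Re by apply: Rmult_le_compat_l; lra.
have : (exp x = (1 - e) * (exp x * (1 + (a - x))) + e * (exp x * (1 + - x)))%Re.
  by rewrite /x; ring.
by lra.
Qed.

(** The rate tolerance depends only on the bound [A], so one choice serves all links. The factor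
    [exp (- A)] absorbs [exp a], and the half leaves room for strictness. *)
Lemma exp_gain_continuity (a A eps : R) : (0 < a <= A)%Re -> (0 < eps)%Re ->
  ((1 - eps) * (exp a - 1) < exp ((1 - eps * exp (- A) / 2) * a) - 1)%Re.
Proof.
move=> [a0 aA] eps0; set e := (eps * exp (- A) / 2)%Re.
have h1 := exp_ineq1_le (- (e * a)); have h2 := exp_ineq1_le a.
have -> : exp ((1 - e) * a) = (exp a * exp (- (e * a)))%Re.
  by rewrite -exp_plus; congr exp; ring.
have h3 : (exp a * (1 + - (e * a)) <= exp a * exp (- (e * a)))%Re.
  by apply: Rmult_le_compat_l => //; apply/Rlt_le/exp_pos.
have h4 : (exp a * exp (- A) <= 1)%Re.
  rewrite -exp_plus -exp_0; case: (Req_dec a A) => [->|ne].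
    by right; congr exp; ring.
  by left; apply: exp_increasing; lra.
have h5 : (exp a * e * a <= eps * a / 2)%Re.
  rewrite (_ : exp a * e * a = (eps * a / 2) * (exp a * exp (- A)))%Re; last first.
    by rewrite /e; field.
  rewrite -[X in (_ <= X)%Re]Rmult_1_r; apply: Rmult_le_compat_l => //; nra.
have h6 : (eps * a <= eps * (exp a - 1))%Re by apply: Rmult_le_compat_l; lra.
have : (0 < eps * a)%Re by apply: Rmult_lt_0_compat.
by nra.
Qed.

Close Scope ring_scope.

Theorem theorem6 (L : nat) (LT LR : 'I_L -> nat)
    (H : forall l k : 'I_L, 'M[Cplx]_(LR l, LT k))
    (Phi : 'I_L -> 'I_L -> bool)
    (hPhi : forall l : 'I_L, Phi l l = false)
    (hrank : forall l : 'I_L, (0 < nstreams H l)%N)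
    (I0 : 'I_L -> R) (hI0 : forall l : 'I_L, Rlt R0 (I0 l))
    (PT : R) (hPT : Rlt R0 PT) :
  (* FOP *)
  maxmin_value_ge1
    (fun Sigma : forall k : 'I_L, 'M[Cplx]_(LT k) =>
       (forall l : 'I_L, psd (Sigma l)) /\
       Rle (Rsum (fun l : 'I_L => cre (mxtrace (Sigma l)))) PT)
    (fun (Sigma : forall k : 'I_L, 'M[Cplx]_(LT k)) (l : 'I_L) =>
       Rdiv (rate H Phi Sigma l) (I0 l))
  <->
  (* EFOP *)
  maxmin_value_ge1
    (fun s : TxVecs H * RxVecs H * Powers H =>
       let: (T, Rv, p) := s in
       (forall (l : 'I_L) (m : 'I_(nstreams H l)),
          cnorm2 (T l m) = R1 /\ cnorm2 (Rv l m) = R1 /\ Rle R0 (p l m)) /\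
       Rle (Rsum (fun l : 'I_L =>
              Rsum (fun m : 'I_(nstreams H l) => Rabs (p l m)))) PT)
    (fun (s : TxVecs H * RxVecs H * Powers H)
         (lm : {l : 'I_L & 'I_(nstreams H l)}) =>
       let: (T, Rv, p) := s in
       Rdiv (sinr Phi T Rv p (projT2 lm))
            (Rminus (exp (Rdiv (I0 (projT1 lm)) (INR (nstreams H (projT1 lm))))) R1)).
Proof.
have M1 l : (1 <= INR (nstreams H l))%Re.
  by rewrite -[1%Re]/(INR 1); apply/le_INR/leP/hrank.
(* The target rate per stream; [exp (a l) - 1] is then the target SINR. *)
pose a l := (I0 l / INR (nstreams H l))%Re.
have aM l : (INR (nstreams H l) * a l = I0 l)%Re.
  by rewrite /a; field; have := M1 l; lra.
have a0 l : (0 < a l)%Re by apply: Rdiv_lt_0_compat => //; have := M1 l; lra.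
have g0 l : (0 < exp (a l) - 1)%Re by have := exp_ineq1_le (a l); have := a0 l; lra.
split=> hopt eps eps0.
  (* The sum of the targets bounds every [a l], which gives a tolerance common to all links. *)
  have aA l : (0 < a l <= Rsum I0)%Re.
    split=> //; apply: Rle_trans (Rsum_term l (fun j => Rlt_le _ _ (hI0 j))).
    by rewrite -aM; have := M1 l; have := a0 l; nra.
  have e0 : (0 < eps * exp (- Rsum I0) / 2)%Re.
    by have := Rmult_lt_0_compat _ _ eps0 (exp_pos (- Rsum I0)); lra.
  have [Sigma [[pS trS] hrate]] := hopt _ e0.
  have [T [Rv [p [feas power hs]]]] := equal_sinr_strategy hPhi hrank pS.
  exists (T, Rv, p); split; first split=> //.
    apply: Rle_trans trS; apply: Rsum_le => l; apply: Rle_trans (power l).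
    apply: Rsum_le => m; rewrite Rabs_right; first by right.
    by apply: Rle_ge; case: (feas l m) => _ [].
  case=> l m /=; rewrite -/(a l).
  apply: (Rmult_lt_reg_r (exp (a l) - 1)) => //.
  rewrite (_ : forall x, x / (exp (a l) - 1) * (exp (a l) - 1) = x)%Re; last first.
    by move=> x; field; have := g0 l; lra.
  apply: Rlt_le_trans (hs l m).
  apply: (Rlt_le_trans _ _ _ (exp_gain_continuity (aA l) eps0)).
  apply: Rplus_le_compat_r; left; apply: exp_increasing.
  have := hrate l; set e := (_ / 2)%Re; set x := rate _ _ _ _ => h.
  apply: (Rmult_lt_reg_l (INR (nstreams H l))); first by have := M1 l; lra.
  have -> : (INR (nstreams H l) * (x / INR (nstreams H l)) = x / I0 l * I0 l)%Re.
    by field; have := M1 l; have := hI0 l; change R0 with 0%Re; lra.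
  rewrite -Rmult_assoc (Rmult_comm _ (1 - e)) Rmult_assoc aM.
  exact: Rmult_lt_compat_r.
(* The first bound gives [e < eps], hence a strict inequality at the end; the second keeps [e] in
   the range of [exp_convex]. *)
pose e := Rmin (eps / 2) (1 / 2).
have [e1 e2] : (e <= eps / 2)%Re /\ (e <= 1 / 2)%Re.
  by split; [apply: Rmin_l|apply: Rmin_r].
have e0 : (0 < e)%Re by apply: Rmin_glb_lt; change R0 with 0%Re in eps0; lra.
have [[[T Rv] p] [[feas power] hs]] := hopt e e0.
have t1 l m : cnorm2 (T l m) = 1%Re by case: (feas l m).
have r1 l m : cnorm2 (Rv l m) = 1%Re by case: (feas l m) => _ [].
have p0 l m : (0 <= p l m)%Re by case: (feas l m) => _ [].
exists (cov T p); split; first split.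
- by move=> l; apply: psd_cov.
- apply: Rle_trans power; apply: Rsum_le => l; rewrite trace_cov //=.
  by apply: Rsum_le => m; apply: Rle_abs.
move=> l.
(* This constant makes the lower bound on the rate equal to [(1 - e) * I0 l]; by convexity it is at
   most [1 + sinr]. *)
have := @rate_ge_sinr _ _ _ H Phi hPhi T Rv p l (exp ((1 - e) * a l)) p0 (r1 l) (exp_pos _).
rewrite ln_exp => h.
have {h} h : (INR (nstreams H l) * ((1 - e) * a l) <= rate H Phi (cov T p) l)%Re.
  apply: h => m; have := hs (existT _ l m); rewrite /= -/(a l) => h.
  have e01 : (0 <= e <= 1)%Re by lra.
  apply: (Rle_trans _ _ _ (exp_convex (a l) e01)); apply: Rplus_le_compat_l; left.
  have := Rmult_lt_compat_r _ _ _ (g0 l) h.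
  rewrite (_ : forall x, x / (exp (a l) - 1) * (exp (a l) - 1) = x)%Re //.
  by move=> x; field; have := g0 l; lra.
apply: (Rmult_lt_reg_r (I0 l)) => //.
rewrite (_ : forall x, x / I0 l * I0 l = x)%Re; last first.
  by move=> x; field; have := hI0 l; change R0 with 0%Re; lra.
apply: Rlt_le_trans h; rewrite -Rmult_assoc (Rmult_comm _ (1 - e)) Rmult_assoc aM.
apply: Rmult_lt_compat_r => //; change R1 with 1%Re; change R0 with 0%Re in *; lra.
Qed.
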